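(* Let $R$ be a prime ring with extended centroid $C$, and let $K_1,\ldots,K_m,L_1,\ldots,L_n$ be noncentral Lie ideals of $R$, where $m,n\geq 1$. Then $\big[K_1\cdots K_m,\,L_1\cdots L_n\big]=0$ if and only if, for all $1\le j\le m$ and $1\le k\le n$, we have $K_1C=K_jC=L_kC=Ca+C$ for any noncentral element $a\in K_1$ (that is, for every $a\in K_1\setminus Z(R)$).
   Context: Rings are associative, not necessarily with unity. $Z(R)$ is the center of $R$, and $[x,y]:=xy-yx$. For subsets $A,B$ of a ring, $[A,B]$ (resp. $AB$) denotes the additive subgroup generated by all $[x,y]$ (resp. $xy$) with $x\in A$, $y\in B$. A Lie ideal of $R$ is an additive subgroup $L$ with $[L,R]\subseteq L$; it is central if $L\subseteq Z(R)$, noncentral otherwise. $R$ is prime if $xRy=0$ implies $x=0$ or $y=0$. For $R$ prime, $Q_s(R)$ is the Martindale symmetric ring of quotients of $R$ (a prime ring containing $R$), and the extended centroid $C$ is the center of $Q_s(R)$, which is a field. $K_jC$, $L_kC$ denote the $C$-spans of $K_j$, $L_k$ in $Q_s(R)$; $Ca+C=\{\beta a+\gamma:\beta,\gamma\in C\}$. *)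

(* Defs.v *)
From HB Require Import structures.
From mathcomp Require Import all_boot all_algebra.
From mathcomp Require Import boolp classical_sets.

Set Implicit Arguments.
Unset Strict Implicit.
Unset Printing Implicit Defensive.

Import GRing.Theory.
Local Open Scope ring_scope.
Local Open Scope classical_set_scope.
Local Open Scope quotient_scope.

(* Associative rings, not necessarily commutative, with no unity assumed;
   MathComp's own ring structures are all unital. *)
HB.mixin Record Zmodule_isRng R of GRing.Zmodule R := {
  rng_mul : R -> R -> R;
  rng_mulA : associative rng_mul;
  rng_mulDl : left_distributive rng_mul +%R;
  rng_mulDr : right_distributive rng_mul +%R
}.

#[short(type="rngType")]
HB.structure Definition Rng := { R of Zmodule_isRng R & GRing.Zmodule R }.

Reserved Notation "x ** y" (at level 40, left associativity).
Notation "x ** y" := (rng_mul x y) : ring_scope.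

Section AdditiveSubgroups.
Variable V : zmodType.

Definition additive_subgroup (G : set V) : Prop :=
  G 0 /\ forall x y, G x -> G y -> G (x - y).

Definition add_gen (S : set V) : set V := smallest additive_subgroup S.

End AdditiveSubgroups.

Section RngNotions.
Variable R : rngType.

Definition rng_comm (x y : R) : R := x ** y - y ** x.

Definition rng_center : set R := [set z | forall x, z ** x = x ** z].

Definition set_mul (A B : set R) : set R :=
  add_gen [set x ** y | x in A & y in B].

Definition set_comm (A B : set R) : set R :=
  add_gen [set rng_comm x y | x in A & y in B].

(* A 0 A 1 ... A m, bracketed to the left: a family over 'I_m.+1 is nonempty,
   as it must be for its product to make sense without a unity. *)
Definition set_prod (m : nat) (A : 'I_m.+1 -> set R) : set R :=
  foldl set_mul (A ord0) [seq A (lift ord0 i) | i <- enum 'I_m].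

Definition lie_ideal (L : set R) : Prop :=
  additive_subgroup L /\ forall x r, L x -> L (rng_comm x r).

Definition noncentral_lie_ideal (L : set R) : Prop :=
  lie_ideal L /\ ~ (L `<=` rng_center).

Definition rng_ideal (I : set R) : Prop :=
  additive_subgroup I /\ forall x r, I x -> I (r ** x) /\ I (x ** r).

(* A nonzero ideal.  The guard only matters when R = 0, which the condition
   [prime_rng] does not exclude: then I = 0 is accepted, so that the
   construction below yields the zero ring rather than an empty type. *)
Definition nz_ideal (I : set R) : Prop :=
  rng_ideal I /\ ((exists r : R, r <> 0) -> exists2 x, I x & x <> 0).

End RngNotions.

Definition prime_rng (R : rngType) : Prop :=
  forall x y : R, (forall r, x ** r ** y = 0) -> x = 0 \/ y = 0.

Section Ideals.
Variable R : rngType.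
Implicit Types (x y z : R) (I J : set R).

Lemma rng_mul0r x : 0 ** x = 0.
Proof. by apply: (addIr (0 ** x)); rewrite -rng_mulDl !add0r. Qed.

Lemma rng_mulr0 x : x ** 0 = 0.
Proof. by apply: (addIr (x ** 0)); rewrite -rng_mulDr !add0r. Qed.

Lemma rng_mulNr x y : (- x) ** y = - (x ** y).
Proof. by apply: (addIr (x ** y)); rewrite -rng_mulDl !addNr rng_mul0r. Qed.

Lemma rng_mulrN x y : x ** (- y) = - (x ** y).
Proof. by apply: (addIr (x ** y)); rewrite -rng_mulDr !addNr rng_mulr0. Qed.

Lemma subgrp0 (V : zmodType) (G : set V) : additive_subgroup G -> G 0.
Proof. by case. Qed.

Lemma subgrpB (V : zmodType) (G : set V) (x y : V) :
  additive_subgroup G -> G x -> G y -> G (x - y).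
Proof. by case=> _; apply. Qed.

Lemma subgrpN (V : zmodType) (G : set V) (x : V) :
  additive_subgroup G -> G x -> G (- x).
Proof. by move=> sG Gx; rewrite -sub0r; apply: subgrpB => //; case: sG. Qed.

Lemma subgrpD (V : zmodType) (G : set V) (x y : V) :
  additive_subgroup G -> G x -> G y -> G (x + y).
Proof.
by move=> sG Gx Gy; rewrite -[y]opprK; apply: subgrpB => //; apply: subgrpN.
Qed.

Lemma add_gen_subgrp (V : zmodType) (S : set V) : additive_subgroup (add_gen S).
Proof.
split=> [G [[]] //|x y Sx Sy G [sG SG]].
by apply: subgrpB => //; [apply: Sx | apply: Sy].
Qed.

Lemma set_mulP I J x y : I x -> J y -> set_mul I J (x ** y).
Proof. by move=> Ix Jy G [_]; apply; exists x => //; exists y. Qed.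

Lemma set_mul_ind (I J P : set R) : additive_subgroup P ->
  (forall x y, I x -> J y -> P (x ** y)) -> set_mul I J `<=` P.
Proof.
move=> sP IJP z; apply; split=> // _ [x Ix] [y Jy] <-; exact: IJP.
Qed.

Lemma set_mulS I I' J J' : I `<=` I' -> J `<=` J' ->
  set_mul I J `<=` set_mul I' J'.
Proof.
move=> sI sJ; apply: set_mul_ind => [|x y Ix Jy]; first exact: add_gen_subgrp.
exact: set_mulP (sI x Ix) (sJ y Jy).
Qed.

Lemma set_mul_sub I : rng_ideal I -> set_mul I I `<=` I.
Proof. by case=> sI hI; apply: set_mul_ind => // x y /hI-/(_ y)[]. Qed.

Lemma rng_idealT : rng_ideal (setT : set R).
Proof. by split=> //; split. Qed.

Lemma rng_idealI I J : rng_ideal I -> rng_ideal J -> rng_ideal (I `&` J).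
Proof.
move=> [sI hI] [sJ hJ]; split=> [|x r [Ix Jx]].
  split=> [|x y [Ix Jx] [Iy Jy]]; first by split; exact: subgrp0.
  by split; exact: subgrpB.
by have [? ?] := hI x r Ix; have [? ?] := hJ x r Jx.
Qed.

Lemma rng_idealM I J : rng_ideal I -> rng_ideal J -> rng_ideal (set_mul I J).
Proof.
move=> [sI hI] [sJ hJ]; split=> [|z r]; first exact: add_gen_subgrp.
apply: (set_mul_ind (P := [set z | set_mul I J (r ** z) /\
                                   set_mul I J (z ** r)])).
  split=> [|x y [x1 x2] [y1 y2]].
    rewrite /= rng_mulr0 rng_mul0r.
    by split; exact: (subgrp0 (add_gen_subgrp _)).
  rewrite /= rng_mulDl rng_mulDr rng_mulrN rng_mulNr.
  by split; exact: (subgrpB (add_gen_subgrp _)).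
move=> x y Ix Jy /=; rewrite rng_mulA -[x ** y ** r]rng_mulA.
have [[rx _] [_ yr]] := (hI x r Ix, hJ y r Jy).
by split; exact: set_mulP.
Qed.

Lemma nz_idealT : nz_ideal (setT : set R).
Proof. by split=> [|[r r0]]; [exact: rng_idealT | exists r]. Qed.

Hypothesis pR : prime_rng R.

Lemma prime_rng_nz x y : x <> 0 -> y <> 0 -> exists r, x ** r ** y <> 0.
Proof.
move=> x0 y0; apply: contrapT => h.
have [r|//|//] := pR (x := x) (y := y).
by apply: contrapT => xry; apply: h; exists r.
Qed.

Lemma nz_idealM I J : nz_ideal I -> nz_ideal J -> nz_ideal (set_mul I J).
Proof.
move=> [iI nI] [iJ nJ]; split=> [|nR]; first exact: rng_idealM.
have [[x Ix x0] [y Jy y0]] := (nI nR, nJ nR).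
have [r xry] := prime_rng_nz x0 y0; exists (x ** r ** y) => //.
by have [_ xr] := iI.2 x r Ix; exact: set_mulP.
Qed.

Lemma nz_idealI I J : nz_ideal I -> nz_ideal J -> nz_ideal (I `&` J).
Proof.
move=> [iI nI] [iJ nJ]; split=> [|nR]; first exact: rng_idealI.
have [[x Ix x0] [y Jy y0]] := (nI nR, nJ nR).
have [r xry] := prime_rng_nz x0 y0; exists (x ** r ** y) => //; split.
  by case: (iI.2 (x ** r) y) => //; case: (iI.2 x r Ix).
by case: (iJ.2 y (x ** r) Jy).
Qed.

End Ideals.

(* The elements of the Martindale symmetric ring of quotients are represented
   by balanced pairs (f, g) on a nonzero ideal I: f : I -> R is a right R-module
   map (x |-> q x), g : I -> R is a left R-module map (x |-> x q), and
   (x q) y = x (q y).  The values of f and g outside I are junk, erased by the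
   relation [bp_eq], and [Qs] is the quotient by that relation. *)
Record balanced_pair (R : rngType) := BalancedPair {
  bp_dom : set R;
  bp_l : R -> R;
  bp_r : R -> R;
  bp_dom_nz : nz_ideal bp_dom;
  bp_lD : forall x y, bp_dom x -> bp_dom y -> bp_l (x + y) = bp_l x + bp_l y;
  bp_lM : forall x r, bp_dom x -> bp_l (x ** r) = bp_l x ** r;
  bp_rD : forall x y, bp_dom x -> bp_dom y -> bp_r (x + y) = bp_r x + bp_r y;
  bp_rM : forall x r, bp_dom x -> bp_r (r ** x) = r ** bp_r x;
  bp_bal : forall x y, bp_dom x -> bp_dom y -> bp_r x ** y = x ** bp_l y
}.

Section PairOperations.
Variables (R : rngType) (pR : prime_rng R).
Implicit Types (p q s : balanced_pair R) (x y z : R).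

Definition bp_eq p q : Prop :=
  exists2 J : set R, nz_ideal J & J `<=` bp_dom p `&` bp_dom q /\
    forall x, J x -> bp_l p x = bp_l q x /\ bp_r p x = bp_r q x.

Lemma bp_dom_subgrp p : additive_subgroup (bp_dom p).
Proof. by case: (bp_dom_nz p) => [[]]. Qed.
Hint Resolve bp_dom_subgrp : core.

Lemma bp_domM p x r : bp_dom p x -> bp_dom p (r ** x) /\ bp_dom p (x ** r).
Proof. by case: (bp_dom_nz p) => [[_]] + _ => /[apply]. Qed.

Lemma bp_l0 p : bp_l p 0 = 0.
Proof.
apply: (addIr (bp_l p 0)).
by rewrite -bp_lD ?add0r //; exact: subgrp0.
Qed.

Lemma bp_r0 p : bp_r p 0 = 0.
Proof.
apply: (addIr (bp_r p 0)).
by rewrite -bp_rD ?add0r //; exact: subgrp0.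
Qed.

Lemma bp_lN p x : bp_dom p x -> bp_l p (- x) = - bp_l p x.
Proof.
move=> px; apply: (addIr (bp_l p x)).
by rewrite -bp_lD ?addNr ?bp_l0 //; exact: subgrpN.
Qed.

Lemma bp_rN p x : bp_dom p x -> bp_r p (- x) = - bp_r p x.
Proof.
move=> px; apply: (addIr (bp_r p x)).
by rewrite -bp_rD ?addNr ?bp_r0 //; exact: subgrpN.
Qed.

Lemma bp_eq_refl p : bp_eq p p.
Proof. by exists (bp_dom p) => //; exact: bp_dom_nz. Qed.

Lemma bp_eq_sym p q : bp_eq p q -> bp_eq q p.
Proof.
case=> J nJ [sJ eJ]; exists J => //; split=> [x /sJ[]//|x /eJ[-> ->]//].
Qed.

Lemma bp_eq_trans q p s : bp_eq p q -> bp_eq q s -> bp_eq p s.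
Proof.
case=> J nJ [sJ eJ] [J' nJ' [sJ' eJ']]; exists (J `&` J').
  exact: nz_idealI.
split=> [x [/sJ[? ?] /sJ'[? ?]]//|x [/eJ[-> ->] /eJ'[-> ->]]//].
Qed.

Lemma bp_eqI p q :
  (forall x, bp_dom p x -> bp_dom q x ->
     bp_l p x = bp_l q x /\ bp_r p x = bp_r q x) -> bp_eq p q.
Proof.
move=> e; exists (bp_dom p `&` bp_dom q).
  by apply: nz_idealI => //; exact: bp_dom_nz.
by split=> // x [] ? ?; apply: e.
Qed.

Definition bp_embed (a : R) : balanced_pair R.
Proof.
refine (@BalancedPair R setT (fun x => a ** x) (fun x => x ** a) _ _ _ _ _ _).
- exact: nz_idealT.
- by move=> *; rewrite rng_mulDr.
- by move=> *; rewrite rng_mulA.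
- by move=> *; rewrite rng_mulDl.
- by move=> *; rewrite rng_mulA.
- by move=> *; rewrite rng_mulA.
Defined.

Definition bp_one : balanced_pair R.
Proof.
by refine (@BalancedPair R setT id id _ _ _ _ _ _); first exact: nz_idealT.
Defined.

Definition bp_opp p : balanced_pair R.
Proof.
refine (@BalancedPair R (bp_dom p) (fun x => - bp_l p x) (fun x => - bp_r p x)
  _ _ _ _ _ _).
- exact: bp_dom_nz.
- by move=> *; rewrite bp_lD // opprD.
- by move=> *; rewrite bp_lM // rng_mulNr.
- by move=> *; rewrite bp_rD // opprD.
- by move=> *; rewrite bp_rM // rng_mulrN.
- by move=> *; rewrite rng_mulNr bp_bal // rng_mulrN.
Defined.

Definition bp_add p q : balanced_pair R.
Proof.
refine (@BalancedPair R (bp_dom p `&` bp_dom q)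
  (fun x => bp_l p x + bp_l q x) (fun x => bp_r p x + bp_r q x) _ _ _ _ _ _).
- by apply: nz_idealI => //; exact: bp_dom_nz.
- by move=> x y [? ?] [? ?]; rewrite !bp_lD // addrACA.
- by move=> x r [? ?]; rewrite !bp_lM // rng_mulDl.
- by move=> x y [? ?] [? ?]; rewrite !bp_rD // addrACA.
- by move=> x r [? ?]; rewrite !bp_rM // rng_mulDr.
- by move=> x y [? ?] [? ?]; rewrite rng_mulDl !bp_bal // rng_mulDr.
Defined.

Definition mul_dom (I J : set R) : set R := set_mul (I `&` J) (I `&` J).

Lemma mul_domP p (I : set R) : rng_ideal I -> I `<=` bp_dom p ->
  forall z, set_mul I I z -> [/\ I z, I (bp_l p z) & I (bp_r p z)].
Proof.
move=> [sI hI] sIp z Iz.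
have Iz1 : I z by apply: set_mul_sub Iz; split.
suff /(_ z Iz)[_ []] : set_mul I I `<=`
    [set z | bp_dom p z /\ I (bp_l p z) /\ I (bp_r p z)] by split.
apply: set_mul_ind => [|x y Ix Iy /=]; last first.
  have [px py] := (sIp x Ix, sIp y Iy).
  split; first by case: (bp_domM y px).
  rewrite bp_lM // bp_rM //; split.
    by case: (hI y (bp_l p x) Iy).
  by case: (hI x (bp_r p y) Ix).
split=> [|x y [px [lx rx]] [py [ly ry]]] /=.
  by rewrite bp_l0 bp_r0; split; [exact: subgrp0 | split; exact: subgrp0].
have pNy : bp_dom p (- y) by exact: subgrpN.
rewrite bp_lD // bp_rD // bp_lN // bp_rN //.
by split; [exact: subgrpB | split; exact: subgrpB].
Qed.

Lemma mul_dom_stable p q z : mul_dom (bp_dom p) (bp_dom q) z ->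
  [/\ bp_dom p z /\ bp_dom q z,
      bp_dom p (bp_l q z) /\ bp_dom q (bp_l q z) &
      bp_dom p (bp_r p z) /\ bp_dom q (bp_r p z)].
Proof.
move=> pqz.
have iI : rng_ideal (bp_dom p `&` bp_dom q).
  by apply: rng_idealI; [case: (bp_dom_nz p) | case: (bp_dom_nz q)].
have [? _ ?] := mul_domP iI (@subIsetl _ _ _) pqz.
by have [_ ? _] := mul_domP iI (@subIsetr _ _ _) pqz.
Qed.

(* On the square of the intersection of the domains both compositions are
   defined: if x, y lie in that intersection, then q (x y) = (q x) y does too. *)
Definition bp_mul p q : balanced_pair R.
Proof.
refine (@BalancedPair R (mul_dom (bp_dom p) (bp_dom q))
  (fun x => bp_l p (bp_l q x)) (fun x => bp_r q (bp_r p x)) _ _ _ _ _ _).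
- have nI : nz_ideal (bp_dom p `&` bp_dom q).
    by apply: nz_idealI => //; exact: bp_dom_nz.
  exact: nz_idealM.
- by move=> x y /mul_dom_stable[[? ?] [? ?] _] /mul_dom_stable[[? ?] [? ?] _];
     rewrite !bp_lD.
- by move=> x r /mul_dom_stable[[? ?] [? ?] _]; rewrite !bp_lM.
- by move=> x y /mul_dom_stable[[? ?] _ [? ?]] /mul_dom_stable[[? ?] _ [? ?]];
     rewrite !bp_rD.
- by move=> x r /mul_dom_stable[[? ?] _ [? ?]]; rewrite !bp_rM.
- by move=> x y /mul_dom_stable[[? ?] _ [? ?]] /mul_dom_stable[[? ?] [? ?] _];
     rewrite bp_bal // bp_bal.
Defined.

Lemma bp_opp_eq p p' : bp_eq p p' -> bp_eq (bp_opp p) (bp_opp p').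
Proof.
by case=> J nJ [sJ eJ]; exists J => //; split=> [//|x /eJ[/= -> ->]].
Qed.

Lemma bp_add_eq p p' q q' : bp_eq p p' -> bp_eq q q' ->
  bp_eq (bp_add p q) (bp_add p' q').
Proof.
case=> J nJ [sJ eJ] [J' nJ' [sJ' eJ']]; exists (J `&` J').
  exact: nz_idealI.
by split=> [x [/sJ[? ?] /sJ'[? ?]]//|x [/eJ[/= -> ->] /eJ'[-> ->]]].
Qed.

Lemma bp_mul_eq p p' q q' : bp_eq p p' -> bp_eq q q' ->
  bp_eq (bp_mul p q) (bp_mul p' q').
Proof.
case=> J nJ [sJ eJ] [J' nJ' [sJ' eJ']].
have nI : nz_ideal (J `&` J') by exact: nz_idealI.
exists (set_mul (J `&` J') (J `&` J')); first exact: nz_idealM.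
split=> [x Jx|x Jx].
  by split; apply: set_mulS Jx => y [/sJ[? ?] /sJ'[? ?]].
have sp' : J `&` J' `<=` bp_dom p' by move=> y [/sJ[]].
have sq' : J `&` J' `<=` bp_dom q' by move=> y [_ /sJ'[]].
have [[Jx1 J'x1] _ [_ J'rx]] := mul_domP nI.1 sp' Jx.
have [_ [Jlx _] _] := mul_domP nI.1 sq' Jx.
rewrite /=; have [-> _] := eJ' _ J'x1; have [_ ->] := eJ _ Jx1.
by have [-> _] := eJ _ Jlx; have [_ ->] := eJ' _ J'rx.
Qed.

Definition bp_choice := {classic (balanced_pair R)}.

Definition bp_rel (p q : bp_choice) : bool := `[< bp_eq p q >].

Lemma bp_rel_refl : reflexive bp_rel.
Proof. by move=> p; apply/asboolP; exact: bp_eq_refl. Qed.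

Lemma bp_rel_sym : symmetric bp_rel.
Proof. by move=> p q; apply/asboolP/asboolP; exact: bp_eq_sym. Qed.

Lemma bp_rel_trans : transitive bp_rel.
Proof.
by move=> q p s /asboolP pq /asboolP qs; apply/asboolP; apply: bp_eq_trans qs.
Qed.

Definition bp_equiv := EquivRel bp_rel bp_rel_refl bp_rel_sym bp_rel_trans.

Definition Qs := {eq_quot bp_equiv}.
HB.instance Definition _ := Choice.on Qs.
HB.instance Definition _ := EqQuotient.on Qs.

Definition toQs (p : balanced_pair R) : Qs := \pi_Qs (p : bp_choice).

Lemma toQsP p q : toQs p = toQs q <-> bp_eq p q.
Proof. by split=> [/eqmodP/asboolP//|e]; apply/eqmodP/asboolP. Qed.

Lemma toQsW (P : Qs -> Prop) : (forall p, P (toQs p)) -> forall a, P a.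
Proof. by move=> h a; rewrite -[a]reprK; apply: h. Qed.

Definition Qs_opp (a : Qs) : Qs := toQs (bp_opp (repr a)).
Definition Qs_add (a b : Qs) : Qs := toQs (bp_add (repr a) (repr b)).
Definition Qs_mul (a b : Qs) : Qs := toQs (bp_mul (repr a) (repr b)).

Lemma repr_toQs p : bp_eq (repr (toQs p)) p.
Proof. by apply/toQsP; rewrite /toQs reprK. Qed.

Lemma Qs_oppE p : Qs_opp (toQs p) = toQs (bp_opp p).
Proof. by apply/toQsP/bp_opp_eq; exact: repr_toQs. Qed.

Lemma Qs_addE p q : Qs_add (toQs p) (toQs q) = toQs (bp_add p q).
Proof. by apply/toQsP/bp_add_eq; exact: repr_toQs. Qed.

Lemma Qs_mulE p q : Qs_mul (toQs p) (toQs q) = toQs (bp_mul p q).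
Proof. by apply/toQsP/bp_mul_eq; exact: repr_toQs. Qed.

Lemma Qs_addA : associative Qs_add.
Proof.
elim/toQsW=> p; elim/toQsW=> q; elim/toQsW=> s.
rewrite !Qs_addE; apply/toQsP/bp_eqI => x _ _ /=.
by rewrite !addrA.
Qed.

Lemma Qs_addC : commutative Qs_add.
Proof.
elim/toQsW=> p; elim/toQsW=> q.
rewrite !Qs_addE; apply/toQsP/bp_eqI => x _ _ /=.
by rewrite addrC [bp_r p x + _]addrC.
Qed.

Lemma Qs_add0 : left_id (toQs (bp_embed 0)) Qs_add.
Proof.
elim/toQsW=> p; rewrite !Qs_addE; apply/toQsP/bp_eqI => x _ _ /=.
by rewrite rng_mul0r rng_mulr0 !add0r.
Qed.

Lemma Qs_addN : left_inverse (toQs (bp_embed 0)) Qs_opp Qs_add.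
Proof.
elim/toQsW=> p; rewrite Qs_oppE !Qs_addE; apply/toQsP/bp_eqI => x _ _ /=.
by rewrite rng_mul0r rng_mulr0 !addNr.
Qed.

HB.instance Definition _ := GRing.isZmodule.Build Qs
  Qs_addA Qs_addC Qs_add0 Qs_addN.

Lemma Qs_mulA : associative Qs_mul.
Proof.
elim/toQsW=> p; elim/toQsW=> q; elim/toQsW=> s.
by rewrite !Qs_mulE; apply/toQsP/bp_eqI.
Qed.

Lemma Qs_mul1 : left_id (toQs bp_one) Qs_mul.
Proof. by elim/toQsW=> p; rewrite !Qs_mulE; apply/toQsP/bp_eqI. Qed.

Lemma Qs_mulr1 : right_id (toQs bp_one) Qs_mul.
Proof. by elim/toQsW=> p; rewrite !Qs_mulE; apply/toQsP/bp_eqI. Qed.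

Lemma Qs_mulDl : left_distributive Qs_mul +%R.
Proof.
elim/toQsW=> p; elim/toQsW=> q; elim/toQsW=> s.
rewrite /GRing.add /= !(Qs_addE, Qs_mulE); apply/toQsP/bp_eqI => x.
move=> /mul_dom_stable[_ _ [_ _]].
by case=> /mul_dom_stable[_ _ [? ?]] /mul_dom_stable[_ _ [? ?]]; rewrite /= bp_rD.
Qed.

Lemma Qs_mulDr : right_distributive Qs_mul +%R.
Proof.
elim/toQsW=> p; elim/toQsW=> q; elim/toQsW=> s.
rewrite /GRing.add /= !(Qs_addE, Qs_mulE); apply/toQsP/bp_eqI => x.
move=> /mul_dom_stable[_ [_ _] _].
by case=> /mul_dom_stable[_ [? ?] _] /mul_dom_stable[_ [? ?] _]; rewrite /= bp_lD.
Qed.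

HB.instance Definition _ := GRing.Zmodule_isPzRing.Build Qs
  Qs_mulA Qs_mul1 Qs_mulr1 Qs_mulDl Qs_mulDr.

Definition Qs_embed (a : R) : Qs := toQs (bp_embed a).

Lemma Qs_embedB a b : Qs_embed (a - b) = Qs_embed a - Qs_embed b.
Proof.
rewrite /GRing.add /GRing.opp /= /Qs_embed Qs_oppE Qs_addE.
apply/toQsP/bp_eqI => x _ _ /=.
by rewrite rng_mulDl rng_mulDr rng_mulNr rng_mulrN.
Qed.

Lemma Qs_embedM a b : Qs_embed (a ** b) = Qs_embed a * Qs_embed b.
Proof.
rewrite /GRing.mul /= /Qs_embed Qs_mulE; apply/toQsP/bp_eqI => x _ _ /=.
by rewrite !rng_mulA.
Qed.

Lemma Qs_embed_inj : injective Qs_embed.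
Proof.
move=> a b /toQsP[J [[_ hJ] nJ] [_ eJ]]; apply: contrapT => ab.
have ab0 : a - b <> 0 by move/eqP; rewrite subr_eq0 => /eqP.
have [|x Jx x0] := nJ; first by exists (a - b).
have [r h] := prime_rng_nz pR ab0 x0; apply: h.
rewrite -rng_mulA rng_mulDl rng_mulNr; have [Jrx _] := hJ x r Jx.
by have [/= -> _] := eJ _ Jrx; rewrite subrr.
Qed.

Definition ext_centroid : set Qs := [set c | forall u : Qs, c * u = u * c].

(* ext_centroid is a subring with 1, so this additive subgroup is the C-span. *)
Definition Cspan (A : set R) : set Qs :=
  add_gen [set c * Qs_embed a | c in ext_centroid & a in A].

Definition Caff (a : R) : set Qs :=
  [set b * Qs_embed a + c | b in ext_centroid & c in ext_centroid].

End PairOperations.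

Arguments ext_centroid {R} pR.
Arguments Cspan {R} pR A%_classical_set_scope.
Arguments Caff {R} pR a.

(* Main.v *)
(* Two commuting noncentral Lie ideals are, by Martindale's lemma applied to
   [a,r] s [b,t] = - [b,r] s [a,t], both contained in Ca + C, and the
   characteristic is 2; their C-spans contain 1, hence equal Ca + C.  A product
   of noncentral Lie ideals is again a noncentral Lie ideal, so this covers
   K_1...K_m and L_1...L_n.  To pass to the factors: once some noncentral Lie
   ideal B commutes with another one, the C-span of every noncentral Lie ideal
   contains 1, so if KL commutes with B then so do K and L. *)
Require Import Defs.
From HB Require Import structures.
From mathcomp Require Import all_boot all_algebra.
From mathcomp Require Import boolp classical_sets.

Set Implicit Arguments.
Unset Strict Implicit.
Unset Printing Implicit Defensive.

Import GRing.Theory.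
Local Open Scope ring_scope.
Local Open Scope classical_set_scope.

(** * Commutators, commuting sets and Lie ideals *)

Section Commutators.
Variable R : rngType.
Implicit Types (x y z r s : R) (A B K L S : set R).

Definition commuting_sets A B := forall x y, A x -> B y -> x ** y = y ** x.

Lemma rng_comm_eq0 x y : rng_comm x y = 0 <-> x ** y = y ** x.
Proof.
by split=> [/eqP|xy]; rewrite /rng_comm ?xy ?subrr // subr_eq0 => /eqP.
Qed.

Lemma rng_mulBr x y z : x ** (y - z) = x ** y - x ** z.
Proof. by rewrite rng_mulDr rng_mulrN. Qed.

Lemma rng_mulBl x y z : (x - y) ** z = x ** z - y ** z.
Proof. by rewrite rng_mulDl rng_mulNr. Qed.

Lemma rng_comm_opp x y : - rng_comm x y = rng_comm y x.
Proof. by rewrite /rng_comm opprB. Qed.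

Lemma rng_commDr x y z : rng_comm x (y + z) = rng_comm x y + rng_comm x z.
Proof. by rewrite /rng_comm rng_mulDr rng_mulDl opprD addrACA. Qed.

Lemma rng_commMr x r s :
  rng_comm x (r ** s) = r ** rng_comm x s + rng_comm x r ** s.
Proof.
rewrite /rng_comm rng_mulBr rng_mulBl !rng_mulA.
by rewrite [RHS]addrC addrA subrK.
Qed.

Lemma rng_commMl x y r :
  rng_comm (x ** y) r = x ** rng_comm y r + rng_comm x r ** y.
Proof.
by rewrite /rng_comm rng_mulBr rng_mulBl !rng_mulA addrA subrK.
Qed.

Lemma noncentralP x : ~ rng_center x -> exists r, rng_comm x r <> 0.
Proof.
move=> ncx; apply: contrapT => h; apply: ncx => r.
by apply/rng_comm_eq0; apply: contrapT => xr; apply: h; exists r.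
Qed.

Lemma noncentral_lie_idealP K : noncentral_lie_ideal K ->
  exists2 x, K x & ~ rng_center x.
Proof.
move=> [_ ncK]; apply: contrapT => h; apply: ncK => x Kx.
by apply: contrapT => ncx; apply: h; exists x.
Qed.

Lemma commuting_setsC A B : commuting_sets A B -> commuting_sets B A.
Proof. by move=> AB x y Bx Ay; exact/esym/AB. Qed.

Lemma set_comm_eq0 A B : A 0 -> B 0 ->
  set_comm A B = [set 0] <-> commuting_sets A B.
Proof.
move=> A0 B0; split=> [AB x y Ax By|AB].
  have : set_comm A B (rng_comm x y).
    by move=> G [_]; apply; exists x => //; exists y.
  by rewrite AB => /rng_comm_eq0.
apply/seteqP; split=> [z zAB|_ -> G [[]] //].
apply: (zAB [set 0]); split=> [|_ [x Ax [y By <-]]] /=.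
  by split=> // x y -> ->; rewrite subr0.
by apply/rng_comm_eq0/AB.
Qed.

Lemma centralizer_subgrp S :
  additive_subgroup [set x | forall y, S y -> x ** y = y ** x].
Proof.
split=> [y _|x z xS zS y Sy]; first by rewrite rng_mul0r rng_mulr0.
by rewrite rng_mulBl rng_mulBr xS ?zS.
Qed.

Lemma lie_idealI K L : lie_ideal K -> lie_ideal L -> lie_ideal (K `&` L).
Proof.
move=> [sK hK] [sL hL]; split=> [|x r [Kx Lx]]; last first.
  by split; [apply: hK|apply: hL].
split=> [|x y [Kx Lx] [Ky Ly]]; first by split; exact: subgrp0.
by split; exact: subgrpB.
Qed.

Lemma lie_idealM K L : lie_ideal K -> lie_ideal L -> lie_ideal (set_mul K L).
Proof.
move=> [sK hK] [sL hL].
have sKL := @add_gen_subgrp R [set x ** y | x in K & y in L].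
split=> // z r.
apply: (@set_mul_ind _ _ _ [set z | set_mul K L (rng_comm z r)]).
  split=> [|x y /= Kx Ky] /=.
    by rewrite /rng_comm rng_mul0r rng_mulr0 subrr; exact: subgrp0 sKL.
  suff -> : rng_comm (x - y) r = rng_comm x r - rng_comm y r.
    exact: (subgrpB sKL).
  rewrite /rng_comm rng_mulBl rng_mulBr !opprB [r ** y - _]addrC addrACA.
  by rewrite [- _ + _]addrC.
move=> x y Kx Ly /=; rewrite rng_commMl; apply: (subgrpD sKL).
  by apply: set_mulP => //; exact: hL.
by apply: set_mulP => //; exact: hK.
Qed.

End Commutators.

(** * Products of noncentral Lie ideals in a prime ring *)

Section PrimeRng.
Variables (R : rngType) (pR : prime_rng R).
Implicit Types (x y z r s a b : R) (A B K L S : set R).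

Lemma prime_centerM x y :
  rng_center x -> rng_center (x ** y) -> x <> 0 -> rng_center y.
Proof.
move=> cx cxy x0 r; apply/rng_comm_eq0.
case: (pR (x := x) (y := rng_comm y r)) => // s.
have e t : x ** rng_comm y t = 0.
  have /rng_comm_eq0 := cxy t; rewrite rng_commMl.
  by have /rng_comm_eq0 -> := cx t; rewrite rng_mul0r addr0.
by rewrite cx -rng_mulA e rng_mulr0.
Qed.

(** Suppose all products are central and take [x] in [K], [y] in [L] noncentral. Then [[x,s] y] is
    central, and so is [[x,s] y y = [x, s y] y], because [[x y, y] = 0] gives [[x,y] y = 0]. As [y]
    is noncentral, [[x,s] y = 0] for all [s]. Replacing [s] by [r s] yields [[x,r] R y = 0], against
    primeness. *)
Lemma noncentral_lie_idealM K L : noncentral_lie_ideal K ->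
  noncentral_lie_ideal L -> noncentral_lie_ideal (set_mul K L).
Proof.
move=> nK nL; have [lK _] := nK; have [lL _] := nL.
split=> [|cKL]; first exact: lie_idealM.
have [y Ly ncy] := noncentral_lie_idealP nL.
have [x Kx /noncentralP[r xr0]] := noncentral_lie_idealP nK.
have cy u : K u -> rng_center (u ** y).
  by move=> Ku; apply: cKL; exact: set_mulP.
have xy0 s : rng_comm x s ** y = 0.
  apply: contrapT => nz; apply: ncy.
  apply: (@prime_centerM (rng_comm x s ** y)) => //.
    by apply: cy; exact: lK.2.
  have xyy : rng_comm x y ** y = 0.
    have /rng_comm_eq0 := cy x Kx y; rewrite rng_commMl.
    by rewrite {1}/rng_comm subrr rng_mulr0 add0r.
  have -> : rng_comm x s ** y ** y = rng_comm x (s ** y) ** y.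
    by rewrite rng_commMr [RHS]rng_mulDl -[s ** _ ** y]rng_mulA xyy rng_mulr0
      add0r.
  by apply: cy; exact: lK.2.
case: (pR (x := rng_comm x r) (y := y)) => // [s|y0].
  have := xy0 (r ** s); rewrite rng_commMr rng_mulDl -rng_mulA xy0 rng_mulr0.
  by rewrite add0r.
by apply: ncy => s; rewrite y0 rng_mul0r rng_mulr0.
Qed.

(** * How the ring of quotients multiplies into [R] *)

Local Notation Q := (Qs pR).
Local Notation C := (ext_centroid pR).
Local Notation e := (Qs_embed pR).

Lemma Qs_embed0 : e 0 = 0.
Proof. by rewrite -(subrr 0) Qs_embedB subrr. Qed.

Lemma Qs_embedN x : e (- x) = - e x.
Proof. by rewrite -sub0r Qs_embedB Qs_embed0 sub0r. Qed.

Lemma Qs_embed_comm x y : e (rng_comm x y) = e x * e y - e y * e x.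
Proof. by rewrite /rng_comm Qs_embedB !Qs_embedM. Qed.

Lemma toQs_mul_embed (p : balanced_pair R) x :
  bp_dom p x -> toQs pR p * e x = e (bp_l p x).
Proof.
move=> px; rewrite /GRing.mul /= /Qs_embed Qs_mulE.
apply/toQsP; apply: bp_eqI => // y; rewrite /= => py _.
have [[py1 _] _ _] := mul_dom_stable (q := bp_embed x) py.
by rewrite bp_lM // bp_bal.
Qed.

Lemma nz_ideal_annl J x : nz_ideal J -> (forall y, J y -> x ** y = 0) -> x = 0.
Proof.
move=> [iJ nJ] xJ; apply: contrapT => x0.
have [|y Jy y0] := nJ; first by exists x.
have [r] := prime_rng_nz pR x0 y0; apply; rewrite -rng_mulA xJ //.
by case: (iJ.2 y r Jy).
Qed.

Lemma Qs_dom (q : Q) : exists2 J, nz_ideal J &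
  forall x, J x -> exists y, q * e x = e y.
Proof.
elim/toQsW: q => p; exists (bp_dom p); first exact: bp_dom_nz.
by move=> x px; exists (bp_l p x); exact: toQs_mul_embed.
Qed.

(** The left component vanishes on [J] within the domain. By balancedness each value of the right
    component annihilates that ideal, so it vanishes too. *)
Lemma Qs_ideal_annl (q : Q) J : nz_ideal J ->
  (forall x, J x -> q * e x = 0) -> q = 0.
Proof.
elim/toQsW: q => p nJ p0.
have nI : nz_ideal (J `&` bp_dom p) by apply: nz_idealI => //; exact: bp_dom_nz.
have l0 x : J x -> bp_dom p x -> bp_l p x = 0.
  move=> Jx px; apply: (@Qs_embed_inj _ pR).
  by rewrite -toQs_mul_embed // p0 // Qs_embed0.
rewrite -Qs_embed0; apply/toQsP; exists (J `&` bp_dom p) => //.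
split=> [x []//|x [Jx px] /=]; rewrite rng_mul0r rng_mulr0 l0 //.
split=> //; apply: nz_ideal_annl nI _ => y [Jy py].
by rewrite bp_bal // l0 // rng_mulr0.
Qed.

Lemma Qs_prime_annl (q : Q) x :
  x <> 0 -> (forall r, q * e (r ** x) = 0) -> q = 0.
Proof.
move=> x0 qx; have [J nJ qJ] := Qs_dom q.
apply: (Qs_ideal_annl nJ) => y Jy; have [z qy] := qJ y Jy.
rewrite qy; case: (pR (x := z) (y := x)) => // [r|->]; last exact: Qs_embed0.
apply: (@Qs_embed_inj _ pR); rewrite -rng_mulA Qs_embedM -qy -mulrA -Qs_embedM.
by rewrite rng_mulA qx Qs_embed0.
Qed.

(** Wherever [u x] lies in [R], [q] commutes with both [x] and [u x], so [q u - u q] kills a nonzero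
    ideal. *)
Lemma ext_centroidP (q : Q) : (forall r, q * e r = e r * q) -> C q.
Proof.
move=> qR u; have [J nJ uJ] := Qs_dom u.
apply/eqP; rewrite -subr_eq0; apply/eqP.
apply: (Qs_ideal_annl nJ) => x /uJ[y uy].
by rewrite mulrBl -!mulrA qR uy mulrA uy qR subrr.
Qed.

(** * The extended centroid is a field; Martindale's lemma *)

Lemma ext_centroid0 : C 0. Proof. by move=> u; rewrite mul0r mulr0. Qed.
Lemma ext_centroid1 : C 1. Proof. by move=> u; rewrite mul1r mulr1. Qed.

Lemma ext_centroidB c d : C c -> C d -> C (c - d).
Proof. by move=> cc cd u; rewrite mulrBl mulrBr cc cd. Qed.

Lemma ext_centroidN c : C c -> C (- c).
Proof. by rewrite -sub0r; apply: ext_centroidB; exact: ext_centroid0. Qed.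

Lemma ext_centroidM c d : C c -> C d -> C (c * d).
Proof. by move=> cc cd u; rewrite -mulrA cd mulrA cc mulrA. Qed.

Lemma ext_centroid_embed z : rng_center z -> C (e z).
Proof. by move=> cz; apply: ext_centroidP => r; rewrite -!Qs_embedM cz. Qed.

Lemma rng_center_embed z : C (e z) -> rng_center z.
Proof. by move=> cz r; apply: (@Qs_embed_inj _ pR); rewrite !Qs_embedM cz. Qed.

(* The domain on which multiplication by the quotient z/x is defined consists
   of all u such that [u t z = v t x] (t in R) for some v, which is then
   unique by primeness. *)
Lemma martindale x z : x <> 0 -> (forall t, x ** t ** z = z ** t ** x) ->
  exists2 c, C c &
    forall u v, (forall t, u ** t ** z = v ** t ** x) -> c * e u = e v.
Proof.
move=> x0 xz; pose rel u v := forall t, u ** t ** z = v ** t ** x.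
have relI u v w : rel u v -> rel u w -> v = w.
  move=> uv uw; apply/eqP; rewrite -subr_eq0; apply/eqP.
  case: (pR (x := v - w) (y := x)) => // t.
  by rewrite !rng_mulBl -uv -uw subrr.
have relB u v u' v' : rel u v -> rel u' v' -> rel (u - u') (v - v').
  by move=> uv uv' t; rewrite !rng_mulBl uv uv'.
have relMr u v r : rel u v -> rel (u ** r) (v ** r).
  by move=> uv t; have := uv (r ** t); rewrite !rng_mulA.
have relMl u v r : rel u v -> rel (r ** u) (r ** v).
  by move=> uv t; rewrite -!rng_mulA; congr (_ ** _); have := uv t; rewrite
    !rng_mulA.
have rel0 : rel 0 0 by move=> t; rewrite !rng_mul0r.
have relD u v u' v' : rel u v -> rel u' v' -> rel (u + u') (v + v').
  move=> uv /(relB _ _ _ _ rel0) uv'; rewrite -[u']opprK -[v']opprK.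
  by rewrite -[- u']sub0r -[- v']sub0r; exact: relB.
pose I := [set u | exists v, rel u v].
have nI : nz_ideal I.
  split=> [|_]; last by exists x => //; exists z.
  split=> [|u r [v uv]]; last by split; [exists (r ** v)|exists (v ** r)]; auto.
  split=> [|u u' [v uv] [v' uv']]; first by exists 0.
  by exists (v - v'); exact: relB.
(* The default 0 is taken only outside [I], where values of a balanced pair are junk. *)
pose f u := xget 0 [set v | rel u v].
have fP u : I u -> rel u (f u).
  by move=> [v uv]; exact: (xgetPex 0 (ex_intro _ v uv)).
have fE u v : rel u v -> f u = v.
  by move=> uv; apply: relI (uv); apply: fP; exists v.
have fD u v : I u -> I v -> f (u + v) = f u + f v.
  by move=> Iu Iv; apply/fE/relD; exact: fP.
have fMr u r : I u -> f (u ** r) = f u ** r.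
  by move=> Iu; apply/fE/relMr/fP.
have fMl u r : I u -> f (r ** u) = r ** f u.
  by move=> Iu; apply/fE/relMl/fP.
have fb u v : I u -> I v -> f u ** v = u ** f v.
  by move=> Iu Iv; rewrite -fMr // fMl.
(* [f] is a bimodule map, so it serves as both components; this is what makes the quotient
   central. *)
pose p := BalancedPair nI fD fMr fD fMl fb.
have pe u v : rel u v -> toQs pR p * e u = e v.
  by move=> uv; rewrite toQs_mul_embed; [rewrite /= (fE u v)|exists v].
exists (toQs pR p) => //; apply: ext_centroidP => r.
(* Testing on the multiples [s x] suffices: [p] sends [s x] and [r s x] to [s z] and [r s z]. *)
apply/eqP; rewrite -subr_eq0; apply/eqP; apply: (Qs_prime_annl x0) => s.
rewrite Qs_embedM mulrBl -!mulrA -!Qs_embedM.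
rewrite (pe (r ** (s ** x)) (r ** (s ** z))); last exact: (relMl _ _ _ (relMl
  _ _ _ xz)).
by rewrite (pe (s ** x) (s ** z)) -?Qs_embedM ?subrr //; exact: (relMl _ _ _
  xz).
Qed.

Lemma ext_centroid_annl c x : C c -> c * e x = 0 -> x <> 0 -> c = 0.
Proof.
move=> cc cx x0; apply: (Qs_prime_annl x0) => r.
by rewrite Qs_embedM mulrA cc -mulrA cx mulr0.
Qed.

(** If [y = c x] is a nonzero element of [R], the inverse is the quotient [x/y] given by
    Martindale's lemma, since [(d c - 1) x = 0]. *)
Lemma ext_centroid_inv c : C c -> c <> 0 -> exists2 d, C d & d * c = 1.
Proof.
move=> cc c0; have [J nJ cJ] := Qs_dom c.
have [x Jx cx0] : exists2 x, J x & c * e x <> 0.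
  apply: contrapT => h; apply/c0/(Qs_ideal_annl nJ) => x Jx.
  by apply: contrapT => cx; apply: h; exists x.
have [y cx] := cJ x Jx.
have y0 : y <> 0 by move=> y0; apply: cx0; rewrite cx y0 Qs_embed0.
have yx t : y ** t ** x = x ** t ** y.
  by apply: (@Qs_embed_inj _ pR); rewrite !Qs_embedM -cx cc -!mulrA cc !mulrA.
have [d cd dE] := martindale y0 yx.
exists d => //; apply/eqP; rewrite -subr_eq0; apply/eqP.
apply: (@ext_centroid_annl _ x).
- by apply: ext_centroidB; [exact: ext_centroidM | exact: ext_centroid1].
- by rewrite mulrBl mul1r -mulrA cx (dE y x yx) subrr.
- by move=> x0; apply: cx0; rewrite x0 Qs_embed0 mulr0.
Qed.

(** * The spaces [Ca + C] and the C-spans *)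

Lemma Caff_subgrp a : additive_subgroup (Caff pR a).
Proof.
split=> [|_ _ [b Cb [c Cc <-]] [b' Cb' [c' Cc' <-]]].
  by exists 0; [exact: ext_centroid0 | exists 0; rewrite ?mul0r ?addr0 //;
    exact: ext_centroid0].
exists (b - b'); first exact: ext_centroidB.
exists (c - c'); first exact: ext_centroidB.
by rewrite mulrBl opprD addrACA.
Qed.

Lemma Caff_centroid a c : C c -> Caff pR a c.
Proof. by move=> Cc; exists 0; [exact: ext_centroid0 | exists c; rewrite //
  mul0r add0r]. Qed.

Lemma Caff_scale a c q : C c -> Caff pR a q -> Caff pR a (c * q).
Proof.
move=> Cc [b Cb [d Cd <-]]; exists (c * b); first exact: ext_centroidM.
by exists (c * d); [exact: ext_centroidM | rewrite mulrDr mulrA].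
Qed.

Lemma Caff_embed a : Caff pR a (e a).
Proof.
exists 1; first exact: ext_centroid1.
by exists 0; [exact: ext_centroid0 | rewrite mul1r addr0].
Qed.

Lemma Caff_comm a u v : Caff pR a u -> Caff pR a v -> u * v = v * u.
Proof.
move=> [b Cb [c Cc <-]] [b' Cb' [c' Cc' <-]].
have ca : GRing.comm (e a) (b' * e a + c').
  by apply: commrD; [apply: commrM | exact/commr_sym/Cc']; first
    exact/commr_sym/Cb'.
apply/commr_sym/commrD; last exact/commr_sym/Cc.
by apply: commrM; [exact/commr_sym/Cb | exact: commr_sym].
Qed.

Lemma Caff_sub a b : Caff pR b (e a) -> Caff pR a `<=` Caff pR b.
Proof.
move=> ab _ [c Cc [d Cd <-]]; apply: (subgrpD (Caff_subgrp b)).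
  exact: Caff_scale.
exact: Caff_centroid.
Qed.

Lemma Cspan_subgrp A : additive_subgroup (Cspan pR A).
Proof. exact: add_gen_subgrp. Qed.

Lemma Cspan_ind A (P : set Q) : additive_subgroup P ->
  (forall c x, C c -> A x -> P (c * e x)) -> Cspan pR A `<=` P.
Proof. by move=> sP AP q; apply; split=> // _ [c Cc [x Ax <-]]; exact: AP. Qed.

Lemma Cspan_gen A c x : C c -> A x -> Cspan pR A (c * e x).
Proof. by move=> Cc Ax G [_]; apply; exists c => //; exists x. Qed.

Lemma Cspan_embed A x : A x -> Cspan pR A (e x).
Proof. by move=> Ax; rewrite -[e x]mul1r; apply: Cspan_gen => //; exact:
  ext_centroid1. Qed.

Lemma Cspan_scale A c q : C c -> Cspan pR A q -> Cspan pR A (c * q).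
Proof.
move=> Cc; have sA := Cspan_subgrp A.
apply: (@Cspan_ind A [set q | Cspan pR A (c * q)]) => [|d x Cd Ax] /=.
  split=> [|u v /= Au Av] /=; first by rewrite mulr0; exact: subgrp0 sA.
  by rewrite mulrBr; exact: subgrpB sA Au Av.
by rewrite mulrA; apply: Cspan_gen => //; exact: ext_centroidM.
Qed.

Lemma Cspan1 A c : Cspan pR A c -> C c -> c <> 0 -> Cspan pR A 1.
Proof.
move=> Ac Cc c0; have [d Cd <-] := ext_centroid_inv Cc c0.
exact: Cspan_scale.
Qed.

Lemma CspanS A B : A `<=` B -> Cspan pR A `<=` Cspan pR B.
Proof.
move=> AB; apply: Cspan_ind => [|c x Cc Ax]; first exact: Cspan_subgrp.
by apply: Cspan_gen => //; exact: AB.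
Qed.

Lemma Caff_sub_Cspan A a : A a -> Cspan pR A 1 -> Caff pR a `<=` Cspan pR A.
Proof.
move=> Aa A1 _ [c Cc [d Cd <-]]; apply: (subgrpD (Cspan_subgrp A)).
  exact: Cspan_gen.
by rewrite -[d]mulr1; exact: Cspan_scale.
Qed.

(** * Commuting noncentral Lie ideals *)

Lemma skew_prime x y : x <> 0 ->
  (forall s, x ** s ** y = - (y ** s ** x)) -> y + y = 0.
Proof.
move=> x0 xy; have [t xtx] := prime_rng_nz pR x0 x0.
case: (pR (x := y + y) (y := x ** t ** x)) => // s.
(* Two sign changes move [y] to the front in two stages; one change with middle factor [s x t] gives
   the opposite sign. Hence [(y + y) s (x t x) = 0]. *)
have e1 : x ** s ** x ** t ** y = y ** s ** x ** t ** x.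
  have -> : x ** s ** x ** t ** y = x ** s ** (x ** t ** y) by rewrite
    !rng_mulA.
  by rewrite xy rng_mulrN !rng_mulA xy !rng_mulNr opprK.
have := xy (s ** x ** t); rewrite !rng_mulDl !rng_mulA e1 => {1}->.
by rewrite addNr.
Qed.

(* Expanding [b, [a, r s]] = 0 gives [a,r] s [b,t] = - [b,r] s [a,t], to which
   Martindale's lemma applies; the sign forces characteristic 2. *)
Lemma comp_inner_deriv_eq0 a b : ~ rng_center a -> ~ rng_center b ->
  (forall r, rng_comm b (rng_comm a r) = 0) ->
  Caff pR a (e b) /\ (forall r, r + r = 0).
Proof.
move=> nca ncb ba.
have D r s : rng_comm a r ** rng_comm b s + rng_comm b r ** rng_comm a s = 0.
  have := ba (r ** s).
  by rewrite [rng_comm a _]rng_commMr rng_commDr !(rng_commMr b) !ba rng_mulr0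
    rng_mul0r add0r addr0 addrC.
have H r s t :
    rng_comm a r ** s ** rng_comm b t + rng_comm b r ** s ** rng_comm a t = 0.
  have := D r (s ** t); rewrite (rng_commMr b) (rng_commMr a) !rng_mulDr
    !rng_mulA.
  by rewrite addrACA -[X in _ + X]rng_mulDl D rng_mul0r addr0.
have [t0 x0] := noncentralP nca.
(* Otherwise [H] leaves [[b,r] s [a,t0] = 0] for all [r] and [s], making [b] central. *)
have y0 : rng_comm b t0 <> 0.
  move=> y0; apply: ncb => r; apply/rng_comm_eq0.
  case: (pR (x := rng_comm b r) (y := rng_comm a t0)) => // s.
  by have := H r s t0; rewrite y0 rng_mulr0 add0r.
move: (H) x0 y0; set x := rng_comm a t0; set y := rng_comm b t0 => H' x0 y0.
have xy s : x ** s ** y = - (y ** s ** x).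
  by apply/eqP; rewrite -addr_eq0; apply/eqP/H'.
have yy : y + y = 0 by exact: skew_prime x0 xy.
have [t|c Cc cE] := @martindale x y x0.
  by rewrite xy -rng_mulNr -rng_mulNr; congr (_ ** _ ** _); apply/esym/eqP;
    rewrite -addr_eq0 yy.
have cab r : c * e (rng_comm a r) = - e (rng_comm b r).
  rewrite -Qs_embedN; apply: cE => t.
  by rewrite !rng_mulNr; apply/eqP; rewrite -addr_eq0; apply/eqP/H.
split=> [|r].
  (* By [cab], [b + c a] commutes with [R], so it is the constant term. *)
  exists (- c); first exact: ext_centroidN.
  exists (e b + c * e a); last by rewrite mulNr addrCA addNr addr0.
  apply: ext_centroidP => r; apply/eqP; rewrite -subr_eq0; apply/eqP.
  rewrite mulrDl mulrDr opprD addrACA -Qs_embed_comm -mulrA.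
  rewrite [e r * (c * _)]mulrA -(Cc (e r)) -[c * _ * _]mulrA -mulrBr
    -Qs_embed_comm.
  by rewrite cab addrN.
(* The relation [y + y = 0] spreads to all of [R]: [(r + r) s y = r s (y + y)]. *)
case: (pR (x := r + r) (y := y)) => // s.
by rewrite !rng_mulDl -rng_mulDr yy rng_mulr0.
Qed.

(** If 1 is missing from the span, [A] has no nonzero central element and [[a,r] = c a] with no
    constant term. So [a] commutes with [[a,r]], and characteristic 2 makes [a a] central. Then
    [[a, r a] = [a,r] a = c a a] is a central element of [A], hence 0, and [[a,r] R a = 0] forces
    [a] central. *)
Lemma Caff_lie_ideal_Cspan1 A a : lie_ideal A -> A a -> ~ rng_center a ->
  (forall x, A x -> Caff pR a (e x)) -> (forall r, r + r = 0) -> Cspan pR A 1.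
Proof.
move=> [sA lA] Aa nca AC r2; apply: contrapT => A1.
have AZ z : A z -> C (e z) -> z = 0.
  move=> Az Cz; apply: contrapT => z0; apply: A1.
  apply: (Cspan1 (Cspan_embed Az)) => // ez0; apply: z0.
  by apply: (@Qs_embed_inj _ pR); rewrite Qs_embed0.
have ar r : exists2 c, C c & c * e a = e (rng_comm a r).
  have [c Cc [d Cd cd]] := AC _ (lA a r Aa); exists c => //.
  suff d0 : d = 0 by rewrite -cd d0 addr0.
  apply: contrapT => d0; apply: A1; apply: (@Cspan1 _ d) => //.
  have -> : d = e (rng_comm a r) - c * e a by rewrite -cd addrC addKr.
  apply: (subgrpB (Cspan_subgrp A)); last exact: Cspan_gen.
  by apply: Cspan_embed; exact: lA.
have aar r : a ** rng_comm a r = rng_comm a r ** a.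
  have [c Cc cE] := ar r; apply: (@Qs_embed_inj _ pR).
  by rewrite !Qs_embedM -cE mulrA -Cc.
have caa : rng_center (a ** a).
  by move=> r; apply/rng_comm_eq0; rewrite rng_commMl aar r2.
have ara r : rng_comm a r ** a = 0.
  have [c Cc cE] := ar r.
  have -> : rng_comm a r ** a = rng_comm a (r ** a).
    by rewrite rng_commMr [rng_comm a a]subrr rng_mulr0 add0r.
  apply: AZ; first exact: lA.
  rewrite rng_commMr [rng_comm a a]subrr rng_mulr0 add0r Qs_embedM -cE -mulrA
    -Qs_embedM.
  by apply: ext_centroidM => //; exact: ext_centroid_embed.
apply: nca => r; apply/rng_comm_eq0.
case: (pR (x := rng_comm a r) (y := a)) => [s||a0] //.
  have := ara (r ** s); rewrite rng_commMr [LHS]rng_mulDl -rng_mulA ara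
    rng_mulr0.
  by rewrite add0r.
by rewrite a0 /rng_comm rng_mul0r rng_mulr0 subrr.
Qed.

Lemma commuting_lie_ideals_Caff A B a : lie_ideal A -> noncentral_lie_ideal B ->
  commuting_sets A B -> A a -> ~ rng_center a ->
  (forall x, B x -> Caff pR a (e x)) /\ (forall r, r + r = 0).
Proof.
move=> lA nB AB Aa nca.
have h b : B b -> ~ rng_center b -> Caff pR a (e b) /\ (forall r, r + r = 0).
  move=> Bb ncb; apply: comp_inner_deriv_eq0 => // r.
  by apply/rng_comm_eq0/esym/AB => //; exact: lA.2.
split=> [x Bx|]; last first.
  by have [b Bb ncb] := noncentral_lie_idealP nB; case: (h b Bb ncb).
have [cx|ncx] := pselect (rng_center x); last by case: (h x Bx ncx).
by apply: Caff_centroid; exact: ext_centroid_embed.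
Qed.

Lemma Cspan_sub_Caff A a :
  (forall x, A x -> Caff pR a (e x)) -> Cspan pR A `<=` Caff pR a.
Proof.
move=> AC; apply: Cspan_ind => [|c x Cc Ax]; first exact: Caff_subgrp.
by apply: Caff_scale => //; exact: AC.
Qed.

(** Arguing from both sides puts [B] in [Ca + C] and [A] in [Cb + C]; as [a] and [b] lie in each
    other's space, the two spaces coincide. Each span contains 1, hence fills this space. *)
Lemma commuting_Cspan A B a :
  noncentral_lie_ideal A -> noncentral_lie_ideal B ->
  commuting_sets A B -> A a -> ~ rng_center a ->
  Cspan pR A = Caff pR a /\ Cspan pR B = Caff pR a.
Proof.
move=> nA nB AB Aa nca; have [lA _] := nA; have [lB _] := nB.
have [b Bb ncb] := noncentral_lie_idealP nB.
have [BCa r2] := commuting_lie_ideals_Caff lA nB AB Aa nca.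
have [ACb _] := commuting_lie_ideals_Caff lB nA (commuting_setsC AB) Bb ncb.
have [sab sba] := (Caff_sub (ACb a Aa), Caff_sub (BCa b Bb)).
have ACa x : A x -> Caff pR a (e x) by move=> Ax; exact/sba/ACb.
have BCb x : B x -> Caff pR b (e x) by move=> Bx; exact/sab/BCa.
have A1 := Caff_lie_ideal_Cspan1 lA Aa nca ACa r2.
have B1 := Caff_lie_ideal_Cspan1 lB Bb ncb BCb r2.
split; apply/seteqP; split; try exact: Cspan_sub_Caff.
  exact: Caff_sub_Cspan.
by apply: subset_trans (Caff_sub_Cspan Bb B1).
Qed.

(* [K, B] lies in the Lie intersection of K and B.  If [K, B] is not zero, this
   intersection is a noncentral Lie ideal commuting with P, or [K, B] contains a
   nonzero central element, which is invertible in C. *)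
Lemma noncentral_Cspan1 P B K : noncentral_lie_ideal P ->
  noncentral_lie_ideal B -> commuting_sets P B -> noncentral_lie_ideal K ->
  Cspan pR K 1.
Proof.
move=> nP nB PB nK.
have Caff1 A B' : noncentral_lie_ideal A -> noncentral_lie_ideal B' ->
    commuting_sets A B' -> Cspan pR A 1.
  move=> nA nB' AB'; have [a Aa nca] := noncentral_lie_idealP nA.
  have [-> _] := commuting_Cspan nA nB' AB' Aa nca.
  exact/Caff_centroid/ext_centroid1.
have [KB|] := pselect (commuting_sets K B); first exact: Caff1 nK nB KB.
move=> nKB; apply: contrapT => K1; apply: nKB => x b Kx Bb.
apply/rng_comm_eq0; have [[sK lK] _] := nK; have [[sB lB] _] := nB.
have [Kz Bz] : K (rng_comm x b) /\ B (rng_comm x b).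
  by split; [exact: lK | rewrite -rng_comm_opp; apply: (subgrpN sB); exact: lB].
have [cz|ncz] := pselect (rng_center (rng_comm x b)).
  apply: contrapT => z0; apply: K1; apply: (Cspan1 (Cspan_embed Kz)).
    exact: ext_centroid_embed.
  by rewrite -Qs_embed0 => /Qs_embed_inj.
have nKB : noncentral_lie_ideal (K `&` B).
  split=> [|sZ]; last by apply: ncz; apply: sZ; split.
  by apply: lie_idealI; [case: nK | case: nB].
case: K1; apply: (CspanS (@subIsetl _ K B)); apply: (Caff1 _ _ nKB nP).
by move=> u v [_ Bu] Pv; exact/esym/PB.
Qed.

(** * From a product to its factors *)

Lemma commuting_set_mul K L B : noncentral_lie_ideal K ->
  noncentral_lie_ideal L -> noncentral_lie_ideal B ->
  commuting_sets (set_mul K L) B -> commuting_sets K B /\ commuting_sets L B.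
Proof.
move=> nK nL nB KLB; have nKL := noncentral_lie_idealM nK nL.
have K1 := noncentral_Cspan1 nKL nB KLB nK.
have L1 := noncentral_Cspan1 nKL nB KLB nL.
have KLBe x y b : K x -> L y -> B b -> e x * e y * e b = e b * (e x * e y).
  by move=> Kx Ly Bb; rewrite -!Qs_embedM KLB //; exact: set_mulP.
split=> [x b Kx Bb|y b Ly Bb]; apply: (@Qs_embed_inj _ pR); rewrite !Qs_embedM.
  (* The commutation of [x y] with [b] is C-linear in [y], so [y] may be replaced by 1, which lies
     in the C-span of [L]. *)
  suff : Cspan pR L `<=` [set q | e x * q * e b = e b * (e x * q)].
    by move/(_ _ L1); rewrite /= mulr1.
  apply: Cspan_ind => [|c y Cc Ly /=].
    split=> [|u v /= xu xv] /=; first by rewrite !(mulr0, mul0r).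
    by rewrite !(mulrBr, mulrBl) xu xv.
  have -> : e x * (c * e y) = c * (e x * e y) by rewrite mulrA -Cc -mulrA.
  by rewrite -mulrA KLBe // !mulrA Cc.
suff : Cspan pR K `<=` [set q | q * e y * e b = e b * (q * e y)].
  by move/(_ _ K1); rewrite /= mul1r.
apply: Cspan_ind => [|c x Cc Kx /=].
  split=> [|u v /= xu xv] /=; first by rewrite !(mulr0, mul0r).
  by rewrite !(mulrBr, mulrBl) xu xv.
by rewrite -2!(mulrA c) KLBe // !mulrA Cc.
Qed.

Lemma foldl_set_mul_noncentral I (F : I -> set R) (s : seq I) A :
  noncentral_lie_ideal A -> (forall i, noncentral_lie_ideal (F i)) ->
  noncentral_lie_ideal (foldl (@set_mul R) A [seq F i | i <- s]).
Proof.
by move=> + nF; elim: s A => //= i s IH A nA; apply/IH/noncentral_lie_idealM.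
Qed.

(** Induction over all accumulators [A]: the hypothesis for [A F_i] leaves one product to split. *)
Lemma commuting_foldl (I : eqType) (F : I -> set R) (s : seq I) A B :
  noncentral_lie_ideal A -> (forall i, noncentral_lie_ideal (F i)) ->
  noncentral_lie_ideal B ->
  commuting_sets (foldl (@set_mul R) A [seq F i | i <- s]) B ->
  commuting_sets A B /\ forall i, i \in s -> commuting_sets (F i) B.
Proof.
move=> + nF nB; elim: s A => [//|i s IH] A nA /= AsB.
have [|AiB FB] := IH _ _ AsB; first exact: noncentral_lie_idealM.
have [AB iB] := commuting_set_mul nA (nF i) nB AiB.
by split=> // j; rewrite inE => /predU1P[->|/FB].
Qed.

Lemma set_prod_noncentral m (K : 'I_m.+1 -> set R) :
  (forall j, noncentral_lie_ideal (K j)) -> noncentral_lie_ideal (set_prod K).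
Proof.
by move=> nK; exact: (foldl_set_mul_noncentral (F := fun i => K (lift ord0 i))).
Qed.

Lemma commuting_set_prod m (K : 'I_m.+1 -> set R) B :
  (forall j, noncentral_lie_ideal (K j)) -> noncentral_lie_ideal B ->
  commuting_sets (set_prod K) B -> forall j, commuting_sets (K j) B.
Proof.
move=> nK nB KB.
have [K0 Ki] := commuting_foldl (F := fun i => K (lift ord0 i)) (nK ord0)
  (fun i => nK _) nB KB.
by move=> j; case: (unliftP ord0 j) => [i ->|-> //]; apply: Ki; rewrite
  mem_enum.
Qed.

End PrimeRng.

(** The centralizer of [B] is closed under sums and products. *)
Lemma set_prod_commuting (R : rngType) m (K : 'I_m.+1 -> set R) (B : set R) :
  (forall j, commuting_sets (K j) B) -> commuting_sets (set_prod K) B.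
Proof.
move=> KB; rewrite /set_prod.
have : commuting_sets (K ord0) B by exact: KB.
elim: (enum _) (K ord0) => [//|i s IH] A AB /=; apply: IH => z b zAK.
move: b; move: z zAK; apply: set_mul_ind => [|x y Ax Ky b Bb].
  exact: centralizer_subgrp.
by rewrite -rng_mulA (KB _ _ _ Ky Bb) !rng_mulA (AB _ _ Ax Bb).
Qed.

Theorem theoremE (R : rngType) (pR : prime_rng R) (m n : nat)
    (K : 'I_m.+1 -> set R) (L : 'I_n.+1 -> set R)
    (hK : forall j, noncentral_lie_ideal (K j))
    (hL : forall k, noncentral_lie_ideal (L k)) :
  set_comm (set_prod K) (set_prod L) = [set 0] <->
  forall (j : 'I_m.+1) (k : 'I_n.+1) (a : R), K ord0 a -> ~ rng_center a ->
    [/\ Cspan pR (K ord0) = Cspan pR (K j),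
        Cspan pR (K j) = Cspan pR (L k) &
        Cspan pR (L k) = Caff pR a].
Proof.
have nK := set_prod_noncentral pR hK; have nL := set_prod_noncentral pR hL.
rewrite set_comm_eq0; [|exact: subgrp0 nK.1.1|exact: subgrp0 nL.1.1].
split=> [KL j k a Ka nca|KCL].
  (* First the factors of the [K] product are separated, then those of the [L] product. *)
  have KLjk i : commuting_sets (K i) (L k).
    apply: commuting_setsC; move: k; apply: (commuting_set_prod pR) => //.
    by apply: commuting_setsC; move: i; apply: (commuting_set_prod pR).
  have [-> LCa] := commuting_Cspan pR (hK ord0) (hL k) (KLjk ord0) Ka nca.
  (* A noncentral [b] in [K j] links its span to that of [L k], already known to be [Ca + C]. *)
  have [b Kb ncb] := noncentral_lie_idealP (hK j).
  have [KCb LCb] := commuting_Cspan pR (hK j) (hL k) (KLjk j) Kb ncb.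
  by rewrite KCb LCa -LCb LCa.
(* Conversely, every [K j] and [L k] lies in the commutative set [Ca + C], so the factors commute
   pairwise. *)
apply: set_prod_commuting => j; apply: commuting_setsC.
apply: set_prod_commuting => k x y Lx Ky.
have [a Ka nca] := noncentral_lie_idealP (hK ord0).
have [_ KL LCa] := KCL j k a Ka nca.
apply: (@Qs_embed_inj _ pR); rewrite !Qs_embedM.
apply: (@Caff_comm _ _ a); rewrite -LCa; last rewrite -KL; exact: Cspan_embed.
Qed.
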